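(* Let $R$ be a commutative ${\mathbb Q}$-algebra (with $1$), let $M$ be an $R$-module, and let $a\in M^{{\mathbb N}}$ be an $R$-recurrence sequence. Then ${\mathcal Z}(a)=\{n\in{\mathbb N}\mid a(n)=0\}$ is the union of a finite set and finitely many infinite arithmetic progressions.
   Context: ${\mathbb N}=\{0,1,2,\dots\}$. For a commutative ring $R$ and an $R$-module $M$, a sequence $a\in M^{{\mathbb N}}$ is an $R$-recurrence sequence if there exist $d\ge 0$ and $\gamma_0,\dots,\gamma_{d-1}\in R$ with $a(n+d)=\gamma_{d-1}a(n+d-1)+\cdots+\gamma_0 a(n)$ for all $n\in{\mathbb N}$. An infinite arithmetic progression is a set $m+n{\mathbb N}$ with $m\in{\mathbb N}$ and $n$ a positive integer. *)

(* Defs.v *)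
From HB Require Import structures.
From mathcomp Require Import all_boot all_order all_algebra.
Set Implicit Arguments. Unset Strict Implicit. Unset Printing Implicit Defensive.
Import GRing.Theory.
Local Open Scope ring_scope.

Definition is_recurrence (R : comPzRingType) (M : lmodType R) (a : nat -> M) : Prop :=
  exists (d : nat) (gamma : 'I_d -> R),
    forall n : nat, a (n + d)%N = \sum_(i < d) gamma i *: a (n + i)%N.

Definition zero_set (R : comPzRingType) (M : lmodType R) (a : nat -> M) : nat -> Prop :=
  fun n => a n = 0.

(* n lies in the infinite arithmetic progression m + k N (k > 0 required separately) *)
Definition in_AP (m k n : nat) : Prop := exists j : nat, n = (m + k * j)%N.

(* Main.v *)
(* A recurrence a satisfies sum_i f_i a(n + i) = 0 for a monic f over a
   polynomial ring A = Q[x_1, ..., x_r] acting on M through R. As A is noetherian,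
   devissage along a chain of submodules, and then along ideals of A, reduces
   the periodicity of the zero set to sequences with values in A/P with P prime,
   hence in a field finitely generated over Q.

   Call F with F(0) <> 0 "skolem" if there is k > 0 such that for every e and every
   sequence b killed by F^e (acting through the shift), on each class mod k the
   zeros of b are finite in number or exhaust the class. Since k does not depend
   on e, this property climbs the tower of fields: over K(t), expand in Taylor
   series at a point tau with F(0)(tau) <> 0, the j-th coefficients being killed by
   a power of F(tau); over a finite extension, take coordinates and replace F by
   a multiple with coefficients in the base field. Over Z, follow Hansel: for an
   odd prime p not dividing F(0), X^k = 1 + p u + F g, so that p^e b(kn) is a Newton
   series sum_i C(n, i) p^i w_i with integral w_i, and t distinct zeros make every
   value divisible by a power of p that grows with t. *)
Require Import Defs.
From HB Require Import structures.
From mathcomp Require Import all_boot all_order all_algebra all_field.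
From mathcomp Require Import boolp ring zify.
Set Implicit Arguments. Unset Strict Implicit. Unset Printing Implicit Defensive.
Import Order.TTheory GRing.Theory Num.Theory.
Local Open Scope ring_scope.

(** * Polynomials acting on sequences through the shift *)

Section PolynomialAction.
Variables (A : comNzRingType) (V : lmodType A).
Implicit Types (b : nat -> V) (f g q : {poly A}).

(* [q(S) b] at [0], where [S] is the shift. *)
Definition pairing b q : V := \sum_(i < size q) q`_i *: b i.

Lemma pairingE b n q : (size q <= n)%N -> pairing b q = \sum_(i < n) q`_i *: b i.
Proof.
move=> le_q_n; rewrite /pairing (big_ord_widen n (fun i => q`_i *: b i) le_q_n).
rewrite big_mkcond; apply: eq_bigr => i _; case: ltnP => // le_q_i.
by rewrite nth_default // scale0r.
Qed.

Lemma pairing_linear b : linear (pairing b).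
Proof.
move=> a p q; pose n := maxn (size (a *: p + q)) (maxn (size p) (size q)).
rewrite !(@pairingE b n) ?leq_max ?leqnn ?orbT //.
rewrite scaler_sumr -big_split; apply: eq_bigr => i _ /=.
by rewrite coefD coefZ scalerDl scalerA.
Qed.

HB.instance Definition _ b :=
  GRing.isLinear.Build A {poly A} V *:%R (pairing b) (pairing_linear b).

Lemma pairingXn b n : pairing b 'X^n = b n.
Proof.
rewrite (@pairingE b n.+1) ?size_polyXn // big_ord_recr /= coefXn eqxx scale1r.
rewrite big1 ?add0r // => i _; rewrite coefXn eqn_leq andbC leqNgt ltn_ord.
by rewrite scale0r.
Qed.

Lemma eq_Lb b b' q : b =1 b' -> pairing b q = pairing b' q.
Proof. by move=> eqb; apply: eq_bigr => i _; rewrite eqb. Qed.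

Lemma pairing_mul b g q : pairing b (g * q) = pairing (fun n => pairing b (g * 'X^n)) q.
Proof.
rewrite -[q in LHS]coefK poly_def mulr_sumr linear_sum.
by apply: eq_bigr => i _; rewrite -scalerAr linearZ.
Qed.

Lemma pairing_shift b s q : pairing b ('X^s * q) = pairing (fun n => b (n + s)%N) q.
Proof. by rewrite pairing_mul; apply: eq_Lb => n; rewrite -exprD pairingXn addnC. Qed.

(** This is f(S) b = 0 read term by term: [pairing b (f * 'X^n)] is the value of f(S) b at [n]. *)
Definition kills f b := forall n, pairing b (f * 'X^n) = 0.

Lemma kills_mul f b q : kills f b -> pairing b (f * q) = 0.
Proof.
by move=> fb; rewrite pairing_mul {1}/pairing big1 // => i _; rewrite fb scaler0.
Qed.

Lemma kills_shift f b s : kills f b -> kills f (fun n => b (n + s)%N).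
Proof. by move=> fb n; rewrite -pairing_shift mulrCA kills_mul. Qed.

End PolynomialAction.

(* The period [k] depends neither on the exponent [e] nor on [b]: this is what
   allows coefficientwise arguments, where [e] is unbounded. *)
Definition skolem (A : comNzRingType) (F : {poly A}) :=
  exists2 k, (0 < k)%N & forall e r (b : nat -> A^o), kills (F ^+ e) b ->
    (forall N, exists2 n, (N <= n)%N & b (k * n + r)%N = 0) ->
    forall n, b (k * n + r)%N = 0.

Lemma skolem_suff (A : comNzRingType) (F : {poly A}) (k : nat) : (0 < k)%N ->
    (forall e (b : nat -> A^o), kills (F ^+ e) b ->
      (forall N, exists2 n, (N <= n)%N & b (k * n)%N = 0) ->
      forall n, b (k * n)%N = 0) ->
  skolem F.
Proof.
move=> k_gt0 Fk; exists k => // e r b /(@kills_shift _ _ _ _ r) Fb bz n.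
exact: Fk Fb bz n.
Qed.

(** * The integers *)

(** By Legendre's formula the valuation is at most n / (p - 1), and p - 1 is at least 2. Hence p^i /
    i! still carries at least half of the factors p. *)
Lemma double_logn_fact p n : prime p -> (2 < p)%N -> ((logn p n`!).*2 <= n)%N.
Proof.
move=> p_pr p_gt2; rewrite logn_fact //.
(* Keeping the tail n / p^N on the left closes the induction: the new term is counted twice in the
   sum and once as the new tail, and three times it fits in the old tail. *)
suff H N : ((\sum_(1 <= k < N.+1) n %/ p ^ k).*2 + n %/ p ^ N <= n)%N.
  exact: leq_trans (leq_addr _ _) (H n).
elim: N => [|N IHN]; first by rewrite big_geq //= expn0 divn1.
rewrite big_nat_recr //= expnSr divnMA.
set s := (\sum_(_ <= _ < _) _)%N in IHN *; set d := (n %/ p ^ N)%N in IHN *.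
have : (3 * (d %/ p) <= d)%N.
  by apply: leq_trans (leq_trunc_div d p); rewrite mulnC leq_mul2l p_gt2 orbT.
lia.
Qed.

(* In Newton's basis the first [t] terms are the remainder modulo
   [\prod (X - n_j)], so they cannot contribute. *)
Lemma newton_zeros_div (p : nat) (w : nat -> int) (s : seq nat) (m : nat) :
    prime p -> (2 < p)%N -> uniq s ->
    (forall n, n \in s ->
      \sum_(i < n.+1) ('C(n, i) * p ^ i)%N%:Z * w i = 0) ->
  exists2 c : nat, coprime p c & (p ^ (size s)./2 %|
      c * `|(\sum_(i < m.+1) ('C(m, i) * p ^ i)%N%:Z * w i)%R|)%N.
Proof.
move=> p_pr p_gt2 s_uniq sz; have p_gt1 := prime_gt1 p_pr.
set t := size s; pose T := (maxn m (\max_(i <- s) i)).+1.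
pose S (n : nat) := \sum_(i < n.+1) ('C(n, i) * p ^ i)%N%:Z * w i.
have SE n : (n < T)%N -> S n = \sum_(i < T) ('C(n, i) * p ^ i)%N%:Z * w i.
  move=> ltnT; rewrite /S (big_ord_widen T (fun i => ('C(n, i) * p ^ i)%N%:Z * w i) ltnT).
  rewrite big_mkcond; apply: eq_bigr => i _; case: ltnP => // lt_ni.
  by rewrite bin_small ?mul0n ?mul0r.
(* i! is split into its [p]-part p^(v i) and its prime-to-[p] part [c_ i]; the common multiple [c]
   of the latter makes c p^i / i! an integer [a i]. *)
pose v i := logn p i`!; pose c_ i := (i`!`_(p^'))%N.
have fact_vc i : i`! = (p ^ v i * c_ i)%N.
  by rewrite /v -p_part /c_ partnC ?fact_gt0.
have c_gt0 i : (0 < c_ i)%N by rewrite part_gt0.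
pose c := (\prod_(i < T) c_ i)%N.
pose a (i : nat) := (c %/ c_ i * p ^ (i - v i))%N.
have v_le i : ((v i).*2 <= i)%N by apply: double_logn_fact.
have aE (i : 'I_T) n : (c * ('C(n, i) * p ^ i) = a i * n ^_ i)%N.
  have dv : (c_ i %| c)%N by rewrite /c (bigD1 i) //= dvdn_mulr.
  have -> : (p ^ i = p ^ (i - v i) * p ^ v i)%N.
    by rewrite -expnD subnK // (leq_trans _ (v_le i)) // -addnn leq_addr.
  rewrite -bin_ffact fact_vc /a -{1}(divnK dv).
  by move: (c %/ _)%N (p ^ _)%N (p ^ _)%N => x y z; ring.
pose E i : {poly int} := \prod_(j < i) ('X - (j : nat)%:Z%:P).
have EE i (n : nat) : (E i).[n%:Z] = (n ^_ i)%:Z.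
  elim: i => [|i IHi]; first by rewrite /E big_ord0 hornerC.
  rewrite /E big_ord_recr /= hornerM IHi hornerXsubC ffactnSr.
  have [lt_ni|le_in] := ltnP n i; first by rewrite ffact_small ?mul0r.
  by rewrite PoszM subzn.
have sizeE i : size (E i) = i.+1.
  by rewrite /E size_prod_XsubC /index_enum -enumT size_enum_ord.
pose G : {poly int} := \prod_(x <- s) ('X - (x : nat)%:Z%:P).
have Gm : G \is monic by apply: monic_prod_XsubC.
have sizeG : size G = t.+1 by rewrite size_prod_XsubC.
pose Q := \sum_(i < T) ((a i)%:Z * w i) *: Pdiv.Ring.rdivp (E i) G.
pose R := \sum_(i < T) ((a i)%:Z * w i) *: Pdiv.Ring.rmodp (E i) G.
have PE (n : nat) : (n < T)%N -> c%:Z * S n = Q.[n%:Z] * G.[n%:Z] + R.[n%:Z].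
  move=> ltnT; rewrite SE // mulr_sumr -hornerM -hornerD /Q /R mulr_suml.
  rewrite -big_split horner_sum; apply: eq_bigr => i _ /=.
  rewrite -scalerAl -scalerDr -Pdiv.RingMonic.rdivp_eq // hornerZ EE.
  by rewrite mulrA -PoszM aE PoszM mulrAC.
have ltT n : n \in s -> (n < T)%N.
  by move=> ns; rewrite ltnS leq_max (big_rem n ns) /= leq_maxl orbT.
(* [R] has degree below [t] and vanishes at the [t] points of [s]. *)
have R0 : R = 0.
  apply/eqP; apply: contraT => nzR.
  have /(max_poly_roots nzR) : all (root R) [seq x%:Z | x : nat <- s].
    apply/allP => _ /mapP[x xs ->]; rewrite rootE.
    have := PE x (ltT x xs); rewrite /S sz // mulr0 => /esym/eqP.
    have -> : G.[x%:Z] = 0.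
      by rewrite horner_prod (big_rem x xs) /= hornerXsubC subrr mul0r.
    by rewrite mulr0 add0r.
  rewrite map_inj_uniq ?s_uniq => [/(_ isT)|x y []//].
  rewrite size_map -/t ltnNge => /negP[].
  have : all (fun i : 'I_T => size (Pdiv.Ring.rmodp (E i) G) <= t)%N (enum 'I_T).
    apply/allP => i _; rewrite -ltnS -sizeG Pdiv.Ring.ltn_rmodpN0 //.
    exact: monic_neq0.
  move=> /allP szr; rewrite (leq_trans (size_sum _ _ _)) //.
  apply/bigmax_leqP => i _; rewrite (leq_trans (size_scale_leq _ _)) // szr //.
  by rewrite mem_enum.
exists c.
  apply: (big_ind (fun n => coprime p n)) => [|x y px py|i _].
  - exact: coprimen1.
  - by rewrite coprimeMr px.
  - by rewrite /c_ (pnat_coprime (pnat_id p_pr)) // part_pnat.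
have -> : (c * `|(\sum_(i < m.+1) ('C(m, i) * p ^ i)%N%:Z * w i)%R|)%N =
    `|(c%:Z * S m)%R|%N.
  by rewrite abszM.
rewrite PE ?ltnS ?leq_maxl // R0 horner0 addr0 abszM dvdn_mulr //.
rewrite -[(p ^ _)%N]/(`|((p ^ t./2)%N%:Z)%R|)%N -dvdzE /Q horner_sum.
apply: rpred_sum => i _; rewrite hornerZ.
(* Below degree [t] the quotient by [G] is zero; from [t] on, [a i] carries the factor p^(i - v i),
   and i - v i is at least i / 2. *)
have [lt_it|le_ti] := ltnP i t.
  by rewrite Pdiv.Ring.rdivp_small ?sizeG ?sizeE ?ltnS // horner0 mulr0 rpred0.
change (((p ^ t./2)%N%:Z %| (a i)%:Z * w i * (Pdiv.Ring.rdivp (E i) G).[m%:Z])%Z).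
rewrite dvdz_mulr // dvdz_mulr // /a PoszM dvdz_mull // dvdzE /=.
by rewrite dvdn_exp2l //; move: (v_le i) le_ti; rewrite /t; lia.
Qed.


(** A nonzero value x cannot coexist with 2|x| zeros: they would make p^|x| divide x, although p^|x|
    > |x|. *)
Lemma newton_eq0 (p : nat) (w : nat -> int) : prime p -> (2 < p)%N ->
    (forall N, exists2 n, (N <= n)%N &
      \sum_(i < n.+1) ('C(n, i) * p ^ i)%N%:Z * w i = 0) ->
  forall m, \sum_(i < m.+1) ('C(m, i) * p ^ i)%N%:Z * w i = 0.
Proof.
move=> p_pr p_gt2 zs m.
pose S (n : nat) := \sum_(i < n.+1) ('C(n, i) * p ^ i)%N%:Z * w i.
rewrite -/(S m); have [//|nz] := eqVneq (S m) 0.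
have [s s_uniq [s_size sz]] : exists2 s : seq nat, uniq s &
    size s = (`|S m|).*2 /\ forall n, n \in s -> S n = 0.
  elim: (_.*2) => [|t [s s_uniq [s_size sz]]]; first by exists [::].
  have [n len nz_n] := zs (\max_(i <- s) i).+1.
  exists (n :: s); rewrite /= ?s_uniq ?andbT.
    by apply/negP => ns; move: len; rewrite (big_rem n ns) /= gtn_max ltnn.
  split=> [|i]; first by rewrite s_size.
  by rewrite inE => /orP[/eqP->|/sz].
have [c co_c] := newton_zeros_div m p_pr p_gt2 s_uniq sz.
rewrite Gauss_dvdr ?coprimeXl // s_size doubleK => /dvdn_leq.
rewrite absz_gt0 => /(_ nz); rewrite leqNgt => /negP[].
by apply: ltn_expl; rewrite (ltn_trans _ p_gt2).
Qed.

(** Pigeonhole: residues modulo [F] are finite in number, so two powers of X agree; the smaller one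
    cancels because X is coprime to [F]. *)
Lemma exists_dvdp_Xn_sub1 (K : finFieldType) (F : {poly K}) :
  F`_0 != 0 -> exists2 k, (0 < k)%N & F %| 'X^k - 1.
Proof.
move=> F0; have nzF : F != 0 by apply: contraNneq F0 => ->; rewrite coef0.
pose N := #|{: 'rV[K]_(size F)}|.
pose h (i : 'I_N.+1) : 'rV[K]_(size F) := poly_rV ('X^i %% F).
have [h_inj|] := boolP (injectiveb h).
  by move/injectiveP/leq_card: h_inj; rewrite card_ord ltnn.
case/injectivePn => i [j neq_ij].
wlog lt_ij : i j neq_ij / (i < j)%N.
  move=> H eq_h; have [/H|/H|/val_inj eq_ij] := ltngtP i j; first exact.
    by rewrite eq_sym => /(_ neq_ij); apply.
  by rewrite eq_ij eqxx in neq_ij.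
move/(congr1 rVpoly); rewrite !poly_rV_K ?(ltnW (ltn_modpN0 _ _)) // => eq_mod.
exists (j - i)%N; first by rewrite subn_gt0.
have : F %| 'X^i * ('X^(j - i) - 1).
  rewrite mulrBr mulr1 -exprD subnKC ?(ltnW lt_ij) //.
  by rewrite -[_ %| _]/(_ == 0) modpD modpN eq_mod subrr.
rewrite Gauss_dvdpr // coprimep_expr // coprimepX.
by rewrite rootE horner_coef0.
Qed.

Lemma exists_Xn_sub1_mod (p : nat) (F : {poly int}) : prime p ->
    ~~ (p %| F`_0)%Z ->
  exists2 k, (0 < k)%N & exists u g, 'X^k - 1 = p%:Z *: u + F * g.
Proof.
move=> p_pr pF0; pose phi : {rmorphism int -> 'F_p} := intr.
have phi0 z : (phi z == 0) = (p %| z)%Z.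
  by rewrite (dvdz_pcharf (pchar_Fp p_pr)).
have [|k k_gt0] := @exists_dvdp_Xn_sub1 _ (map_poly phi F).
  by rewrite coef_map phi0.
case/dvdpP => gb gbE; exists k => //.
pose g : {poly int} := map_poly (fun x : 'F_p => (x : nat)%:Z) gb.
have gE : map_poly phi g = gb.
  apply/polyP => i; rewrite coef_map coef_map_id0 //=.
  by rewrite -[RHS]natr_Zp.
pose r := 'X^k - 1 - F * g.
have r_p i : (p %| r`_i)%Z.
  rewrite -phi0 -coef_map /r !rmorphB rmorphM /= map_polyXn rmorph1 gE gbE.
  by rewrite mulrC subrr coef0.
exists (map_poly (fun z => z %/ p)%Z r), g.
apply/eqP; rewrite -subr_eq -/r; apply/eqP/polyP => i.
by rewrite coefZ coef_map_id0 ?div0z // mulrC divzK.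
Qed.

Lemma skolem_int (F : {poly int}) : F`_0 != 0 -> skolem F.
Proof.
(* A prime exceeding both 2 and |F(0)| is odd and does not divide F(0). *)
move=> F0; have [p p_gt p_pr] := prime_above (maxn 2 (absz F`_0)).
have [p_gt2 p_gtF] : (2 < p)%N /\ (absz (F`_0)%R < p)%N.
  by apply/andP; rewrite -gtn_max.
have [|k k_gt0 [u [g XkE]]] := @exists_Xn_sub1_mod p F p_pr.
  rewrite dvdzE /=; apply/negP => /dvdn_leq; rewrite absz_gt0 => /(_ F0).
  by rewrite leqNgt p_gtF.
apply: (@skolem_suff _ _ k) => // e b Fb zs m.
pose c i : int := pairing b (('X^k - 1) ^+ i).
have c_div i : (p%:Z ^+ i %| p%:Z ^+ e * c i)%Z.
  (* In the binomial expansion of (p u + F g)^i the terms with j >= e contain F^e and vanish; the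
     others carry p^(i - j) with j < e, and the factor p^e makes up for the missing p^j. *)
  rewrite /c XkE exprDn linear_sum mulr_sumr; apply: rpred_sum => j _.
  change (p%:Z ^+ i %| p%:Z ^+ e * pairing b
    ((p%:Z *: u) ^+ (i - j) * (F * g) ^+ j *+ 'C(i, j)))%Z.
  have [le_ej|lt_je] := leqP e j.
    rewrite -(subnKC le_ej) exprMn exprD mulrCA -!mulrA -mulrnAr.
    by rewrite kills_mul // mulr0 dvdz0.
  rewrite exprZn -scalerAl scalerMnr linearZ /=.
  rewrite [_ *: _](_ : _ = p%:Z ^+ (i - j) *
    pairing b (u ^+ (i - j) * (F * g) ^+ j *+ 'C(i, j))) //.
  rewrite mulrA -exprD dvdz_mulr // -(@subnKC i (e + (i - j))) ?exprD ?dvdz_mulr //.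
  by move: lt_je; case: j => j /= ltj; lia.
pose w i : int := (p%:Z ^+ e * c i %/ p%:Z ^+ i)%Z.
have bE n : p%:Z ^+ e * b (k * n)%N =
    \sum_(i < n.+1) ('C(n, i) * p ^ i)%N%:Z * w i.
  rewrite -(pairingXn b) exprM -[X in X ^+ n](subrK 1) exprD1n linear_sum mulr_sumr.
  apply: eq_bigr => i _; rewrite linearMn /= -/(c i) /w.
  have -> : ('C(n, i) * p ^ i)%N%:Z = 'C(n, i)%:Z * p%:Z ^+ i.
    by rewrite PoszM -!natz natrX.
  rewrite -mulrA [p%:Z ^+ i * _]mulrC divzK // mulrnAr.
  by rewrite -mulr_natl natz.
apply/eqP; have /eqP : p%:Z ^+ e * b (k * m)%N = 0.
  rewrite bE; apply: newton_eq0 => // N.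
  by have [n le_n bn0] := zs N; exists n; rewrite // -bE bn0 mulr0.
rewrite mulf_eq0 expf_eq0 => /orP[/andP[_ /eqP[p0]]|//].
by rewrite p0 in p_pr.
Qed.

(** * Sequences killed by a monic polynomial *)

Section MonicExtension.
Variables (A : comNzRingType) (V : lmodType A) (f : {poly A}).
Hypothesis f_monic : f \is monic.
Import Pdiv.Ring Pdiv.RingMonic.

(** For monic [f], the sequence killed by [f] that has the same first deg f terms as [y]; later
    terms of [y] are not read. *)
Definition extend (y : nat -> V) (n : nat) : V := pairing y (rmodp 'X^n f).

Lemma pairing_extend y q : pairing (extend y) q = pairing y (rmodp q f).
Proof.
rewrite -[q in RHS]coefK poly_def rmodp_sum // linear_sum.
by apply: eq_bigr => i _; rewrite rmodpZ // linearZ.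
Qed.

Lemma kills_extend y : kills f (extend y).
Proof. by move=> n; rewrite pairing_extend mulrC rmodp_mull // linear0. Qed.

Lemma kills_rmodp (b : nat -> V) q : kills f b -> pairing b q = pairing b (rmodp q f).
Proof.
move=> fb; rewrite [q in LHS](rdivp_eq f_monic) linearD /= mulrC.
by rewrite kills_mul // add0r.
Qed.

Lemma size_rmodp_monic q : (size (rmodp q f) <= (size f).-1)%N.
Proof.
have := ltn_rmodpN0 q (monic_neq0 f_monic).
by case: (size f).
Qed.

End MonicExtension.

(** * Transfer of the Skolem property to larger fields *)

Section FractionField.
Variables (D : idomainType) (K : fieldType) (io : {rmorphism D -> K}).
Hypothesis io_inj : injective io.
Hypothesis fracK : forall x, exists2 uv, uv.2 != 0 & x = io uv.1 / io uv.2.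

Lemma common_denominator n (x : nat -> K) :
  exists2 c, c != 0 & exists y, forall i, (i < n)%N -> io c * x i = io (y i).
Proof.
have io0 z : (io z == 0) = (z == 0) by rewrite -(rmorph0 io) (inj_eq io_inj).
elim: n => [|n [c nz_c [y yE]]].
  by exists 1; rewrite ?oner_eq0 //; exists (fun=> 0).
have [[u v] /= nz_v xn] := fracK (x n).
exists (c * v); first by rewrite mulf_neq0.
exists (fun i => if (i < n)%N then v * y i else c * u) => i; rewrite ltnS.
case: ltnP => [lt_in _|le_ni le_in].
  by rewrite !rmorphM -yE //= mulrCA !mulrA.
have -> : i = n by apply/eqP; rewrite eqn_leq le_in.
by rewrite xn !rmorphM /= -mulrA; congr (_ * _); rewrite mulrC divfK // io0.
Qed.

Lemma pairing_scaleX (l : K) (b : nat -> K^o) (q : {poly K}) :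
  pairing (fun n => l ^+ n * b n : K^o) q = pairing b (q \Po (l *: 'X)).
Proof.
rewrite -[q in RHS]coefK poly_def !linear_sum; apply: eq_bigr => i _.
by rewrite /= comp_polyZ comp_Xn_poly exprZn !linearZ /= pairingXn !scalerA mulrC.
Qed.

(* Clearing denominators turns [F] into [G] over [D] with leading coefficient
   [l]; then [l ^+ n * b n] is killed by the monic polynomial [H] determined by
   [l * H (l X) = l ^+ d * G X]. *)
Lemma skolem_fraction :
    (forall F : {poly D}, F \is monic -> F`_0 != 0 -> skolem F) ->
  forall F : {poly K}, F`_0 != 0 -> skolem F.
Proof.
have io0 z : (io z == 0) = (z == 0) by rewrite -(rmorph0 io) (inj_eq io_inj).
move=> skD F F0; have nzF : F != 0 by apply: contraNneq F0 => ->; rewrite coef0.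
have [c nz_c [g gE]] := common_denominator (size F) (nth 0 F).
pose d := (size F).-1; have sF : size F = d.+1 by rewrite polySpred.
pose l := g d; have nz_l : l != 0.
  by rewrite -io0 -gE ?sF // mulf_neq0 ?io0 // -lead_coefE lead_coef_eq0.
(* The leading coefficient 1 is set apart because the natural subtraction d - 1 - i would be
   truncated at i = d. *)
pose h i := if i == d then 1 else g i * l ^+ (d.-1 - i).
pose H := \poly_(i < d.+1) h i.
have sH : size H = d.+1 by rewrite size_poly_eq // /h eqxx oner_eq0.
have H_monic : H \is monic.
  by rewrite monicE lead_coefE sH coef_poly ltnSn /h eqxx.
have H0 : H`_0 != 0.
  rewrite coef_poly /h /=; case: ifP => _; first exact: oner_neq0.
  by rewrite mulf_neq0 ?expf_neq0 // -io0 -gE ?sF // mulf_neq0 ?io0.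
have HE : map_poly io H \Po (io l *: 'X) = (io l ^+ d * io c / io l) *: F.
  rewrite -[map_poly _ _]coefK poly_def linear_sum -[F in RHS]coefK poly_def.
  have nz_il : io l != 0 by rewrite io0.
  rewrite size_map_poly_id0 ?io0 ?lead_coef_eq0 ?monic_neq0 // sH sF scaler_sumr.
  apply: eq_bigr => i _; rewrite /= comp_polyZ comp_Xn_poly exprZn !scalerA.
  congr (_ *: _); rewrite coef_map /= coef_poly ltn_ord /h.
  apply: (mulIf nz_il); rewrite [RHS]mulrAC divfK // -[RHS]mulrA.
  rewrite gE ?sF ?ltn_ord //; case: eqP => [->|neq_id].
    by rewrite rmorph1 mul1r.
  rewrite rmorphM rmorphXn /= -mulrA -exprD -mulrA -exprSr mulrC.
  congr (_ ^+ _ * _).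
  by move: neq_id (ltn_ord i); lia.
have [k k_gt0 skH] := skD H H_monic H0.
apply: (skolem_suff k_gt0) => e b Fb zs n.
pose b' n : K^o := io l ^+ n * b n.
have He_monic : H ^+ e \is monic by rewrite monic_exp.
have Hb' q : pairing b' (map_poly io (H ^+ e) * q) = 0.
  rewrite pairing_scaleX comp_polyM rmorphXn /= rmorphXn /= HE exprZn -scalerAl.
  by rewrite linearZ /= (kills_mul _ Fb) scaler0.
(* Only the first deg(H^e) terms of [b'] need a common denominator: H^e is monic over [D], so the
   later terms of c' b' lie in [D] as well. *)
have [c' nz_c' [y yE]] := common_denominator (size (H ^+ e)).-1 b'.
pose b'' : nat -> D^o := extend (V := D^o) (H ^+ e) y.
have b''E m : io (b'' m) = io c' * io l ^+ m * b m.
  rewrite -mulrA -[_ * b m]/(b' m) -[b' m](pairingXn b') -(map_polyXn io).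
  rewrite (Pdiv.RingMonic.rdivp_eq He_monic 'X^m) rmorphD rmorphM /=.
  rewrite [map_poly io _ * _]mulrC.
  rewrite linearD /= Hb' add0r /b'' /extend.
  have sz := size_rmodp_monic He_monic 'X^m.
  rewrite (pairingE _ sz) (pairingE b' (leq_trans (size_poly _ _) sz)).
  rewrite raddf_sum mulr_sumr.
  apply: eq_bigr => i _; rewrite coef_map mulrCA yE ?ltn_ord //.
  exact: rmorphM.
have bz m : (b m == 0) = (b'' m == 0).
  by rewrite -[RHS]io0 b''E !mulf_eq0 expf_eq0 !io0 (negPf nz_c') (negPf nz_l) andbF.
apply/eqP; rewrite bz; apply/eqP; rewrite -[(k * n)%N]addn0.
apply: (skH e 0%N b'') => [|N]; first exact: kills_extend.
by have [m le_m /eqP bm0] := zs N; exists m => //; rewrite addn0; apply/eqP; rewrite -bz.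
Qed.

End FractionField.

(* With [f = F mod (X - tau)], the power [f ^+ (e + j)] lies in the ideal
   generated by [F ^+ e] and [(X - tau) ^+ j.+1], so it kills the [j]-th Taylor
   coefficients at [tau]. *)
Lemma skolem_poly (K : fieldType) :
    (forall q : {poly K}, q != 0 -> exists tau, q.[tau] != 0) ->
    (forall F : {poly K}, F`_0 != 0 -> skolem F) ->
  forall F : {poly {poly K}}, F`_0 != 0 -> skolem F.
Proof.
move=> infK skK F /infK[tau F0].
pose ev : {rmorphism {poly K} -> K} := horner_eval tau.
pose f := map_poly ev F.
have [|k k_gt0 skf] := skK f; first by rewrite coef_map.
apply: (skolem_suff k_gt0) => e b Fb zs n.
pose taylor (q : {poly K}) := q \Po ('X + tau%:P).
pose c j n : K^o := (taylor (b n))`_j.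
have cE j q : pairing (c j) q = (taylor (pairing b (map_poly polyC q)))`_j.
  rewrite (pairingE b (size_poly (size q) _ : (size (map_poly polyC q) <= _)%N)).
  rewrite /taylor raddf_sum coef_sum; apply: eq_bigr => i _.
  by rewrite coef_map /= comp_polyM comp_polyC coefCM.
(* Coefficients of [F] and of [f] agree at [tau], so X - tau divides their difference. *)
have [G fE] : exists G, map_poly polyC f = F + ('X - tau%:P)%:P * G.
  exists (map_poly (fun p => (p.[tau]%:P - p) %/ ('X - tau%:P)) F).
  apply/polyP => i; rewrite coefD coefCM !coef_map /=.
  rewrite coef_map_id0; last by rewrite horner0 subr0 div0p.
  rewrite mulrC divpK ?subrKC // dvdp_XsubCl.
  by rewrite rootE hornerD hornerN hornerC subrr.
have c_killed j : kills (f ^+ (e + j)) (c j).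
  move=> m; rewrite cE rmorphM /= map_polyXn rmorphXn /= fE exprDn mulr_suml.
  rewrite linear_sum /taylor raddf_sum coef_sum big1 // => i _ /=.
  have [le_ij|lt_ji] := leqP i j.
    rewrite -addnBA // exprD -!mulrA mulrnAl -!mulrA -mulrnAr (kills_mul _ Fb).
    by rewrite comp_poly0 coef0.
  rewrite exprMn mulrCA -mulrnAr -mulrA -rmorphXn /= mul_polyC linearZ /=.
  rewrite comp_polyM rmorphXn /= comp_polyB comp_polyX comp_polyC addrK coefXnM.
  by rewrite lt_ji.
rewrite -[LHS](comp_polyXaddC_K _ tau).
suff -> : b (k * n)%N \Po ('X + tau%:P) = 0 by rewrite comp_poly0.
apply/polyP => j; rewrite coef0; rewrite -[(k * n)%N]addn0.
apply: (skf _ 0%N (c j) (c_killed j)) => N.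
have [m le_m bm0] := zs N; exists m => //.
by rewrite /c addn0 bm0 /taylor comp_poly0 coef0.
Qed.

(** Residues modulo [F] form a finite-dimensional [K]-space, so enough powers of X are linearly
    dependent over [K]; the relation is a multiple of [F]. Its factor X^s is coprime to [F] and can
    be removed. *)
Lemma exists_dvdp_in_alg (K : fieldType) (E : fieldExtType K) (F : {poly E}) :
  F`_0 != 0 -> exists2 N : {poly K}, N`_0 != 0 & F %| map_poly (in_alg E) N.
Proof.
move=> F0; have nzF : F != 0 by apply: contraNneq F0 => ->; rewrite coef0.
pose n := \dim {:E}; pose d := size F.
pose crd (i : 'I_(d * n).+1) : 'M[K]_(d, n) :=
  \matrix_(j, c) coord (vbasis {:E}) c ('X^i %% F)`_j.
pose W := \matrix_i mxvec (crd i).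
have : kermx W != 0.
  rewrite kermx_eq0 -row_leq_rank -ltnNge ltnS; exact: rank_leq_col.
case/rowV0Pn => u /sub_kermxP uW nz_u.
pose N0 : {poly K} := rVpoly u.
have nzN0 : N0 != 0.
  by apply: contraNneq nz_u => N00; rewrite -[u]rVpolyK -/N0 N00 linear0.
have FN0 : F %| map_poly (in_alg E) N0.
  have -> : map_poly (in_alg E) N0 = \sum_i (u 0 i)%:A *: 'X^i.
    rewrite /N0 /rVpoly poly_def rmorph_sum; apply: eq_bigr => i _ /=.
    by rewrite map_polyZ /= map_polyXn valK.
  rewrite -[_ %| _]/(_ == 0).
  have -> : (\sum_i (u 0 i)%:A *: 'X^i) %% F = \sum_i (u 0 i)%:A *: ('X^i %% F).
    by elim/big_rec2: _ => [|i x y _ <-]; rewrite ?mod0p // modpD modpZl.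
  apply/eqP/polyP => j; rewrite coef0 coef_sum.
  have [le_dj|lt_jd] := leqP d j.
    rewrite big1 // => i _; rewrite coefZ nth_default ?mulr0 //.
    by rewrite (leq_trans (ltnW (ltn_modpN0 _ nzF))).
  rewrite (eq_bigr (fun i => u 0 i *: ('X^i %% F)`_j)); last first.
    by move=> i _; rewrite coefZ mulr_algl.
  rewrite [LHS](coord_vbasis (memvf _)) big1 // => c _.
  move/rowP/(_ (mxvec_index (Ordinal lt_jd) c)): uW; rewrite !mxE => uW.
  have -> : coord (vbasis {:E}) c (\sum_i u 0 i *: ('X^i %% F)`_j) = 0.
    rewrite linear_sum -[RHS]uW.
    by apply: eq_bigr => i _; rewrite linearZ /= mxE mxvecE mxE.
  by rewrite scale0r.
have [s [N rootN N0E]] := multiplicity_XsubC N0 0.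
exists N; first by rewrite nzN0 /= rootE horner_coef0 in rootN.
move: FN0; rewrite N0E subr0 rmorphM rmorphXn /= map_polyX.
by rewrite Gauss_dvdpl // coprimep_expr // coprimepX rootE horner_coef0.
Qed.

(** The coordinates of [b] in a [K]-basis of [E] are killed by N^e, because F^e divides N^e over
    [E]. *)
Lemma skolem_fieldExt (K : fieldType) (E : fieldExtType K) :
    (forall F : {poly K}, F`_0 != 0 -> skolem F) ->
  forall F : {poly E}, F`_0 != 0 -> skolem F.
Proof.
move=> skK F /exists_dvdp_in_alg[N N0 /dvdpP[Q NE]].
have [k k_gt0 skN] := skK N N0.
apply: (skolem_suff k_gt0) => e b Fb zs n.
pose c i n : K^o := coord (vbasis {:E}) i (b n).
have c_killed i : kills (N ^+ e) (c i).
  move=> m; have -> q :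
      pairing (c i) q = coord (vbasis {:E}) i (pairing b (map_poly (in_alg E) q)).
    rewrite (pairingE b (size_poly (size q) _ : (size (map_poly (in_alg E) q) <= _)%N)).
    rewrite linear_sum; apply: eq_bigr => j _.
    rewrite coef_map /= -[_%:A *: _]/(_%:A * _) mulr_algl linearZ //.
  rewrite rmorphM rmorphXn /= NE exprMn [Q ^+ e * _]mulrC -mulrA.
  by rewrite (kills_mul _ Fb) linear0.
rewrite [LHS](coord_vbasis (memvf (b (k * n)%N : E))) big1 // => i _.
rewrite -[coord _ _ _]/(c i _) -[(k * n)%N]addn0.
rewrite (skN _ 0%N (c i) (c_killed i)) ?scale0r // => N1.
by have [m le_m bm0] := zs N1; exists m => //; rewrite /c addn0 bm0 linear0.
Qed.

(** * The universal property of the field of fractions *)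

Section Fractions.
Variable D : idomainType.
Local Notation tofrac := (@FracField.tofrac D).
Local Open Scope quotient_scope.

Lemma fraction_quot (x : {fraction D}) :
  exists2 uv : D * D, uv.2 != 0 & x = tofrac uv.1 / tofrac uv.2.
Proof.
elim/quotW: x => r; exists (\n_r, \d_r) => /=; first exact: denom_ratioP.
have nz_d : tofrac \d_r != 0 by rewrite tofrac_eq0 denom_ratioP.
apply: (mulIf nz_d); rewrite divfK //.
rewrite [_ * _]piE; unlock FracField.tofrac; apply/eqmodP => /=.
rewrite FracField.equivfE /= !numden_Ratio ?mulf_neq0 ?denom_ratioP ?oner_neq0 //.
by rewrite !mulr1 mulrC.
Qed.

Lemma fraction_lift (L : fieldType) (f : {rmorphism D -> L}) : injective f ->
  exists g : {rmorphism {fraction D} -> L}, forall d, g (tofrac d) = f d.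
Proof.
move=> f_inj; have f0 z : (f z == 0) = (z == 0).
  by rewrite -(rmorph0 f) (inj_eq f_inj).
(* Choice picks one representation u / v of each fraction; [gfrac] then shows that f u / f v does
   not depend on it. *)
have [g gE] := choice (fun x : {fraction D} =>
  (let: ex_intro2 uv nz e := fraction_quot x in
   ex_intro (fun z => exists2 uv : D * D, uv.2 != 0 &
     x = tofrac uv.1 / tofrac uv.2 /\ z = f uv.1 / f uv.2) _
     (ex_intro2 _ _ uv nz (conj e erefl)))).
have gfrac u v : v != 0 -> g (tofrac u / tofrac v) = f u / f v.
  move=> nz_v; have [[u' v'] /= nz_v' [/eqP e ->]] := gE (tofrac u / tofrac v).
  move: e; rewrite eqr_div ?tofrac_eq0 // -!tofracM tofrac_eq => /eqP e.
  by apply/eqP; rewrite eqr_div ?f0 // -!rmorphM e.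
have gto d : g (tofrac d) = f d.
  by rewrite -[tofrac d]divr1 -tofrac1 gfrac ?oner_eq0 // rmorph1 divr1.
have g_add : zmod_morphism g.
  move=> x y; have [[u v] /= nz_v ->] := fraction_quot x.
  have [[u' v'] /= nz_v' ->] := fraction_quot y.
  rewrite -mulNr addf_div ?tofrac_eq0 // -tofracN -!tofracM -tofracD.
  rewrite !gfrac ?mulf_neq0 // -[in RHS]mulNr addf_div ?f0 //.
  by rewrite rmorphD !rmorphM rmorphN.
have g_mul : monoid_morphism g.
  split=> [|x y]; first by rewrite -tofrac1 gto rmorph1.
  have [[u v] /= nz_v ->] := fraction_quot x.
  have [[u' v'] /= nz_v' ->] := fraction_quot y.
  rewrite mulf_div -!tofracM !gfrac ?mulf_neq0 // !rmorphM.
  by rewrite mulf_div.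
pose gZ := GRing.isZmodMorphism.Build _ _ g g_add.
pose gM := GRing.isMonoidMorphism.Build _ _ g g_mul.
pose gR : {rmorphism {fraction D} -> L} := HB.pack g gZ gM.
by exists gR.
Qed.

End Fractions.

(** * The Skolem property along towers over the rationals *)

Definition skolem_field (K : fieldType) :=
  forall F : {poly K}, F`_0 != 0 -> skolem F.

Lemma skolem_rat : skolem_field rat.
Proof.
apply: (@skolem_fraction int rat intr) => [|x|F _]; first exact: intr_inj.
  exists (numq x, denq x); first by rewrite denq_neq0.
  by rewrite divq_num_den.
exact: skolem_int.
Qed.

(** The elements 0, 1, ..., size q - 1 are distinct and too many to be all roots. *)
Lemma pchar0_non_root (K : fieldType) (q : {poly K}) :
  [pchar K] =i pred0 -> q != 0 -> exists tau, q.[tau] != 0.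
Proof.
move=> K0 nz_q; apply: contrapT => no_tau.
pose s : seq K := [seq n%:R | n <- iota 0 (size q)].
have : (size s < size q)%N.
  apply: max_poly_roots => //.
    apply/allP => x _; rewrite rootE; apply/negPn/negP => nz.
    by apply: no_tau; exists x.
  rewrite map_inj_uniq ?iota_uniq // => m n /eqP.
  wlog le_mn : m n / (m <= n)%N.
    move=> H; case: (leqP m n) => [/H//|/ltnW/H {}H]; rewrite eq_sym => /H ->//.
  rewrite eq_sym -subr_eq0 -natrB // -[_ == 0]/(_ == 0).
  move/eqP=> e; apply/eqP; rewrite eqn_leq le_mn -subn_eq0 /=.
  by rewrite -(proj1 (@pcharf0P _) K0 (n - m)%N) e.
by rewrite size_map size_iota ltnn.
Qed.

(** The image of [phi] lies in a subfield of [L] with the Skolem property. Quantifying over all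
    [phi] lets this pass from [A] to A[X] by adjoining the image of X. *)
Definition skolem_images (A : comNzRingType) :=
  forall (L : fieldType) (phi : {rmorphism A -> L}), [pchar L] =i pred0 ->
  exists2 K : fieldType, skolem_field K &
  exists io : {rmorphism K -> L}, forall a, exists x, phi a = io x.

Lemma skolem_images_rat : skolem_images rat.
Proof.
move=> L phi _; exists rat; first exact: skolem_rat.
by exists phi => a; exists a.
Qed.

(** [E] stands for K(x): it is K[X]/(q), with q of least degree vanishing at [x], if [x] is
    algebraic, and the fraction field of K[X] if [x] is transcendental. *)
Lemma skolem_simple_ext (K L : fieldType) (io : {rmorphism K -> L}) (x : L) :
    [pchar L] =i pred0 -> skolem_field K ->
  exists2 E : fieldType, skolem_field E &
  exists io' : {rmorphism E -> L}, forall q : {poly K}, exists y,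
    (map_poly io q).[x] = io' y.
Proof.
move=> L0 skK.
have [[p pP]|transc] := pselect (exists p : {poly K}, p != 0 /\ root (map_poly io p) x).
  pose P n := `[< exists q : {poly K},
    [/\ q != 0, root (map_poly io q) x & size q = n] >].
  have exP : exists n, P n.
    by exists (size p); apply/asboolP; exists p; case: pP.
  case: (ex_minnP exP) => m /asboolP[q [nz_q qx sq]] min_m.
  have irr_q : irreducible_poly q.
    apply/(subfx_irreducibleP qx nz_q) => r rx nz_r; rewrite sq.
    by apply: min_m; apply/asboolP; exists r.
  pose E : fieldExtType K := SubFieldExtType qx irr_q.
  exists E; first exact: skolem_fieldExt.
  exists (subfx_inj : {rmorphism subFExtend io x q -> L}) => r.
  by exists (subfx_eval io x q r); rewrite /= subfx_inj_eval.
have cfu : commr_rmorph io x by move=> y; apply: mulrC.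
have ev_inj : injective (horner_morph cfu).
  move=> q r /eqP; rewrite -subr_eq0 -rmorphB => /eqP e; apply/eqP.
  rewrite -subr_eq0; apply: contrapT => /negP nz.
  by apply: transc; exists (q - r); split=> //; rewrite rootE; apply/eqP.
have [g gE] := fraction_lift ev_inj.
exists {fraction {poly K}}; last first.
  by exists g => q; exists (FracField.tofrac q); rewrite gE.
apply: (@skolem_fraction _ _ (@FracField.tofrac {poly K})).
- by move=> q r /eqP; rewrite tofrac_eq => /eqP.
- exact: fraction_quot.
move=> F _; apply: skolem_poly skK F => q; apply: pchar0_non_root.
by move=> n; rewrite -(fmorph_pchar io) L0.
Qed.

Lemma skolem_images_poly (A : comNzRingType) :
  skolem_images A -> skolem_images {poly A}.
Proof.
move=> skA L phi L0; pose phi0 : {rmorphism A -> L} := phi \o polyC.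
have [K skK [io ioP]] := skA L phi0 L0.
have [E skE [io' io'P]] := skolem_simple_ext io (phi 'X) L0 skK.
exists E => //; exists io' => q.
suff [r ->] : exists r : {poly K}, phi q = (map_poly io r).[phi 'X].
  exact: io'P.
elim/poly_ind: q => [|q c [r IHr]]; first by exists 0; rewrite !rmorph0 horner0.
have [y yE] := ioP c; exists (r * 'X + y%:P).
rewrite !rmorphD !rmorphM /= map_polyX map_polyC hornerMXaddC IHr.
by rewrite -[phi c%:P]/(phi0 c) yE.
Qed.

(** * Submodules and linear spans *)

Section Submodules.
Variables (A : comNzRingType) (V : lmodType A).
Implicit Types (N : V -> Prop) (s : seq V).

Definition submod N := N 0 /\ forall a x y, N x -> N y -> N (a *: x + y).

Definition lspan s x := exists c : nat -> A, x = \sum_(i < size s) c i *: s`_i.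

Lemma submodZ N a x : submod N -> N x -> N (a *: x).
Proof. by move=> [N0 NL] Nx; rewrite -[_ *: _]addr0; apply: NL. Qed.

Lemma submodD N x y : submod N -> N x -> N y -> N (x + y).
Proof. by move=> [_ NL] Nx Ny; rewrite -[x]scale1r; apply: NL. Qed.

Lemma submodB N x y : submod N -> N x -> N y -> N (x - y).
Proof. by move=> [_ NL] Nx Ny; rewrite addrC -scaleN1r; apply: NL. Qed.

Lemma submod_sum N n (F : 'I_n -> V) :
  submod N -> (forall i, N (F i)) -> N (\sum_(i < n) F i).
Proof.
move=> sN NF; elim/big_ind: _ => [|x y|i _]; [by case: sN | exact: submodD | exact: NF].
Qed.

Lemma lspan_submod s : submod (lspan s).
Proof.
split=> [|a x y [c ->] [c' ->]].
  by exists (fun=> 0); rewrite big1 // => i _; rewrite scale0r.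
exists (fun i => a * c i + c' i); rewrite scaler_sumr -big_split.
by apply: eq_bigr => i _; rewrite scalerDl scalerA.
Qed.

Lemma lspan_mem s x : x \in s -> lspan s x.
Proof.
move=> xs; exists (fun i => (i == index x s)%:R).
have lt_xs : (index x s < size s)%N by rewrite index_mem.
rewrite (bigD1 (Ordinal lt_xs)) //= eqxx scale1r nth_index // big1 ?addr0 //.
by move=> i ne; rewrite (_ : _ == _ = false) ?scale0r //; apply: negPf ne.
Qed.

Lemma lspan_min N s : submod N -> (forall x, x \in s -> N x) ->
  forall x, lspan s x -> N x.
Proof.
move=> sN Ns x [c ->]; apply: submod_sum => // i.
by apply: submodZ => //; apply: Ns; apply: mem_nth.
Qed.

Lemma lspan_cons u s x : lspan (u :: s) x <-> exists a, lspan s (x - a *: u).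
Proof.
split=> [[c ->]|[a [c xE]]].
  exists (c 0%N), (fun i => c i.+1).
  by rewrite /= big_ord_recl /= addrC addKr.
exists (fun i => if i is j.+1 then c j else a).
by rewrite /= big_ord_recl /= -xE addrC subrK.
Qed.

Lemma lspan_mkseq (F : nat -> V) m n x :
  (m <= n)%N -> lspan (mkseq F m) x -> lspan (mkseq F n) x.
Proof.
move=> le_mn; apply: lspan_min; first exact: lspan_submod.
move=> y /mapP[i]; rewrite mem_iota => /= lt_im ->.
by apply/lspan_mem/map_f; rewrite mem_iota (leq_trans lt_im).
Qed.

Lemma lspan_chain (F : nat -> V) s :
    (forall x, x \in s -> exists n, lspan (mkseq F n) x) ->
  exists n, forall x, lspan s x -> lspan (mkseq F n) x.
Proof.
elim: s => [|u s IHs] Fs.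
  exists 0%N => x [c ->]; rewrite big_ord0; exact: (lspan_submod _).1.
have [|m Fm] := IHs; first by move=> x xs; apply: Fs; rewrite inE xs orbT.
have [|n Fn] := Fs u; first by rewrite inE eqxx.
exists (maxn m n); apply: lspan_min; first exact: lspan_submod.
move=> x; rewrite inE => /orP[/eqP->|/lspan_mem/Fm].
  by apply: lspan_mkseq Fn; apply: leq_maxr.
by apply: lspan_mkseq; apply: leq_maxl.
Qed.

End Submodules.

(** * Noetherian rings *)

Definition noetherian (A : comNzRingType) :=
  forall J : A^o -> Prop, submod J -> exists s, forall x, J x <-> lspan s x.

Lemma noetherian_field (K : fieldType) : noetherian K.
Proof.
move=> J sJ; have [[u [Ju nz_u]]|J0] := pselect (exists u, J u /\ u != 0).
  exists [:: u] => x; split=> [_|]; last first.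
    by apply: lspan_min => // y; rewrite inE => /eqP->.
  have -> : x = (x / u : K) *: u by rewrite -[RHS]/(x / u * u) divfK.
  by apply: submodZ; [apply: lspan_submod | apply/lspan_mem/mem_head].
exists [::] => x; split=> [Jx|[c ->]]; last by rewrite big_ord0; case: sJ.
exists (fun=> 0); rewrite big_ord0; apply/eqP; apply: contrapT => /negP nz.
by apply: J0; exists x.
Qed.

Lemma ex_min_size (A : comNzRingType) (P : {poly A} -> Prop) :
  (exists f, P f) -> exists2 f, P f & forall g, P g -> (size f <= size g)%N.
Proof.
move=> [f0 Pf0]; pose Q n := `[< exists2 f, P f & size f = n >].
have exQ : exists n, Q n by exists (size f0); apply/asboolP; exists f0.
case: (ex_minnP exQ) => m /asboolP[f Pf <-] min_f; exists f => // g Pg.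
by apply: min_f; apply/asboolP; exists g.
Qed.

(* Hilbert's basis theorem: otherwise choose [F n] of minimal degree in [J]
   outside the lspan of its predecessors; the leading coefficients then generate
   an ideal that is not finitely generated. *)
Lemma noetherian_poly (A : comNzRingType) : noetherian A -> noetherian {poly A}.
Proof.
move=> nA J sJ; apply: contrapT => not_fg.
(* The inclusion of [s] in [J] is a premise under the existential, so that choice yields a total
   function. *)
have next s : exists f : {poly A}^o, (forall x, x \in s -> J x) ->
    [/\ J f, ~ lspan s f &
        forall g, J g -> ~ lspan s g -> (size (f : {poly A}) <= size (g : {poly A}))%N].
  have [Js|nJs] := pselect (forall x, x \in s -> J x); last by exists 0 => /nJs.
  have [|f [Jf sf] min_f] := @ex_min_size A
      (fun f => J f /\ ~ lspan (s : seq {poly A}^o) f).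
    apply: contrapT => no_f; apply: not_fg; exists s => x; split=> [Jx|].
      by apply: contrapT => nx; apply: no_f; exists x.
    exact: lspan_min.
  by exists f => _; split=> // g Jg sg; apply: min_f.
have {next} [nxt nxtP] := choice next.
pose S := fix S n := if n is m.+1 then rcons (S m) (nxt (S m)) else [::].
pose F n : {poly A}^o := nxt (S n).
have SE n : S n = mkseq F n by elim: n => //= n IHn; rewrite mkseqS -IHn.
have FS n : forall x, x \in S n -> J x.
  elim: n => //= n IHn x; rewrite mem_rcons inE => /orP[/eqP->|/IHn//].
  by case: (nxtP _ IHn).
have FP n : [/\ J (F n), ~ lspan (mkseq F n) (F n) &
    forall g, J g -> ~ lspan (mkseq F n) g ->
      (size (F n : {poly A}) <= size (g : {poly A}))%N].
  by rewrite -SE; apply: nxtP; apply: FS.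
have F_nz n : (F n : {poly A}) != 0.
  have [_ sF _] := FP n; apply/eqP => F0; apply: sF; rewrite F0.
  exact: (lspan_submod _).1.
have F_size i n : (i <= n)%N -> (size (F i : {poly A}) <= size (F n : {poly A}))%N.
  move=> le_in; have [_ _ minF] := FP i; have [JF sF _] := FP n.
  by apply: minF => // /(lspan_mkseq le_in).
pose lc n : A^o := lead_coef (F n).
pose I x := exists n, lspan (mkseq lc n) x.
have [|s sI] := nA I.
  split=> [|a x y [m mx] [n ny]]; first by exists 0%N; apply: (lspan_submod _).1.
  exists (maxn m n); apply: (lspan_submod _).2.
    by apply: lspan_mkseq mx; apply: leq_maxl.
  by apply: lspan_mkseq ny; apply: leq_maxr.
have [n Fn] : exists n, forall x, lspan s x -> lspan (mkseq lc n) x.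
  by apply: lspan_chain => x /lspan_mem /sI.
have : lspan (mkseq lc n) (lc n).
  apply: Fn; apply/sI; exists n.+1; apply/lspan_mem/map_f.
  by rewrite mem_iota /= ltnSn.
rewrite /lspan size_mkseq => -[c lcE].
have [JF sF minF] := FP n.
pose d := (size (F n : {poly A})).-1.
have sFn : size (F n : {poly A}) = d.+1 by rewrite polySpred.
(* Each [F i] is raised to the degree of [F n], and the combination is such that the leading term
   cancels in F n - h. *)
pose h := \sum_(i < n) (c i *: 'X^(d.+1 - size (F i : {poly A}))) *: F i.
have hF : lspan (mkseq F n) h.
  apply: submod_sum => [|i]; first exact: lspan_submod.
  apply: submodZ; first exact: lspan_submod.
  by apply/lspan_mem/map_f; rewrite mem_iota /=.
have Jh : J h.
  by apply: lspan_min hF => // x /mapP[i _ ->]; case: (FP i).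
have : (size ((F n - h)%R : {poly A}) <= d)%N.
  apply/leq_sizeP => j le_dj; rewrite coefB coef_sum.
  have s_gt0 (i : 'I_n) : (0 < size (F i : {poly A}))%N by rewrite size_poly_gt0.
  have s_le (i : 'I_n) : (size (F i : {poly A}) <= d.+1)%N.
    by rewrite -sFn F_size // ltnW.
  have hE (i : 'I_n) : (((c i *: 'X^(d.+1 - size (F i : {poly A}))) *: F i) : {poly A})`_j
      = c i * (F i : {poly A})`_(j - (d.+1 - size (F i : {poly A}))).
    rewrite -[_ *: F i]/(_ * (F i : {poly A})) -scalerAl coefZ coefXnM.
    by case: ltnP => //; move: (s_gt0 i) le_dj; lia.
  rewrite (eq_bigr _ (fun i _ => hE i)).
  move: le_dj; rewrite leq_eqVlt => /orP[/eqP <-|lt_dj].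
    rewrite {1}/d -lead_coefE -[lead_coef _]/(lc n) lcE -sumrB big1 // => i _.
    rewrite nth_mkseq // -[_ *: _]/(_ * lead_coef (F i : {poly A})) lead_coefE.
    rewrite (_ : (d - _)%N = (size (F i : {poly A})).-1) ?subrr //.
    by move: (s_gt0 i) (s_le i); lia.
  rewrite nth_default ?sFn // big1 ?subrr // => i _.
  have le_j : (size (F i : {poly A}) <= j - (d.+1 - size (F i : {poly A})))%N.
    by move: lt_dj (s_gt0 i) (s_le i); lia.
  by rewrite nth_default ?mulr0.
rewrite leqNgt => /negP[]; rewrite -sFn; apply: minF; first exact: submodB.
move=> sFh; apply: sF; rewrite -[F n](subrK h).
by apply: submodD => //; apply: lspan_submod.
Qed.

(** A counterexample would start an endless strictly increasing chain of counterexamples. The union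
    of the chain is finitely generated, so one member contains all generators and equals the
    next. *)
Lemma noetherian_ind (A : comNzRingType) (P : (A^o -> Prop) -> Prop) :
    noetherian A ->
    (forall J, submod J ->
      (forall J', submod J' -> (forall x, J x -> J' x) ->
         (exists2 x, J' x & ~ J x) -> P J') -> P J) ->
  forall J, submod J -> P J.
Proof.
move=> nA IH J0 sJ0; apply: contrapT => nPJ0.
pose T := {J : A^o -> Prop | submod J /\ ~ P J}.
have next (J : T) : exists J' : T, (forall x, sval J x -> sval J' x) /\
    exists2 x, sval J' x & ~ sval J x.
  case: J => J [sJ nPJ] /=; apply: contrapT => no_next; apply: nPJ.
  apply: IH => // J' sJ' sub strict; apply: contrapT => nPJ'.
  by apply: no_next; exists (exist _ J' (conj sJ' nPJ')).
have [nxt nxtP] := choice next.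
pose C n := iter n nxt (exist _ J0 (conj sJ0 nPJ0) : T).
have sC n : submod (sval (C n)) by case: (C n) => J [].
have C_mono m n x : (m <= n)%N -> sval (C m) x -> sval (C n) x.
  move=> le_mn Cx; rewrite -(subnK le_mn); elim: (n - m)%N => //= i IHi.
  exact: (nxtP _).1.
pose U x := exists n, sval (C n) x.
have [|s sU] := nA U.
  split=> [|a x y [m mx] [n ny]]; first by exists 0%N; case: (sC 0%N).
  exists (maxn m n); apply: (sC _).2.
    by apply: C_mono mx; apply: leq_maxl.
  by apply: C_mono ny; apply: leq_maxr.
have [n sCn] : exists n, forall x, x \in s -> sval (C n) x.
  have : forall x, x \in s -> U x by move=> x /lspan_mem/sU.
  elim: (s) => [|u r IHr] Ur; first by exists 0%N.
  have [|m Cm] := IHr; first by move=> x xr; apply: Ur; rewrite inE xr orbT.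
  have [|n Cn] := Ur u; first exact: mem_head.
  exists (maxn m n) => x; rewrite inE => /orP[/eqP->|/Cm].
    by apply: C_mono Cn; apply: leq_maxr.
  by apply: C_mono; apply: leq_maxl.
have [_ [x Cx []]] := nxtP (C n).
apply: (lspan_min (sC n) sCn); apply/sU.
by exists n.+1.
Qed.

(** * Ultimately periodic sets *)

Definition ultimately_periodic (Z : nat -> Prop) := exists N k, (0 < k)%N /\
  forall n, (N <= n)%N -> Z n <-> Z (n + k)%N.

Lemma up_iff Z Z' :
  ultimately_periodic Z -> (forall n, Z n <-> Z' n) -> ultimately_periodic Z'.
Proof.
move=> [N [k [k_gt0 Zk]]] ZZ'; exists N, k; split=> // n le_n.
by rewrite -!ZZ'; apply: Zk.
Qed.

Lemma up_const Z N :
  (forall m n, (N <= m)%N -> (N <= n)%N -> Z m -> Z n) -> ultimately_periodic Z.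
Proof.
move=> cZ; exists N, 1%N; split=> // n le_n.
by split; apply: cZ => //; apply: leq_trans (leq_addr _ _).
Qed.

Lemma up_shift Z s : ultimately_periodic (fun n => Z (n + s)%N) -> ultimately_periodic Z.
Proof.
move=> [N [k [k_gt0 Zk]]]; exists (N + s)%N, k; split=> // n le_n.
have le_sn : (s <= n)%N := leq_trans (leq_addl _ _) le_n.
have := Zk (n - s)%N; rewrite subnK // addnAC subnK // leq_subRL // addnC.
exact.
Qed.

Lemma up_mul Z N k j n : (forall n, (N <= n)%N -> Z n <-> Z (n + k)%N) ->
  (N <= n)%N -> Z n <-> Z (n + k * j)%N.
Proof.
move=> Zk le_n; elim: j => [|j IHj]; first by rewrite muln0 addn0.
rewrite IHj mulnSr addnA; apply: Zk.
exact: leq_trans (leq_addr _ _).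
Qed.

Lemma up_classes Z k : (0 < k)%N ->
  (forall r, ultimately_periodic (fun n => Z (k * n + r)%N)) -> ultimately_periodic Z.
Proof.
move=> k_gt0 Zr; have [N NP] := choice Zr; have [p pP] := choice NP.
(* The sum of the thresholds bounds each of them, and the product of the periods is a multiple of
   each. *)
pose M := (\sum_(r < k) N r)%N; pose q := (\prod_(r < k) p r)%N.
exists (k * M)%N, (k * q)%N; split.
  by rewrite muln_gt0 k_gt0 /q prodn_gt0 // => r; case: (pP r).
move=> n le_n; rewrite (divn_eq n k) [(_ * k)%N]mulnC.
set r := (n %% k)%N; have lt_rk : (r < k)%N by rewrite ltn_mod.
rewrite -addnA [(r + _)%N]addnC addnA -mulnDr.
have [_ Zp] := pP r.
rewrite /q (bigD1 (Ordinal lt_rk)) //=.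
apply: (@up_mul (fun n => Z (k * n + r)%N) _ _ _ _ Zp).
apply: (@leq_trans M); last by rewrite leq_divRL // mulnC.
by rewrite /M (bigD1 (Ordinal lt_rk)) //= leq_addr.
Qed.

Lemma up_zero_set (T : eqType) (a : nat -> T) (z : T) :
    ultimately_periodic (fun n => a n = z) ->
  exists (F : seq nat) (P : seq (nat * nat)),
    (forall p, p \in P -> (0 < p.2)%N) /\
    forall n, a n = z <-> (n \in F \/ exists2 p, p \in P & in_AP p.1 p.2 n).
Proof.
move=> [N [k [k_gt0 aN]]].
(* Zeros below [N] form the finite set; each zero in [N, N + k) starts a progression of difference
   [k]. *)
exists [seq n <- iota 0 N | a n == z], [seq (n, k) | n <- iota N k & a n == z].
split=> [p /mapP[n _ ->] //|n].
split=> [an|[|[p /mapP[m + ->] /= [j ->]]]]; last 2 first.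
- by rewrite mem_filter => /andP[/eqP].
- rewrite mem_filter mem_iota => /andP[/eqP am /andP[le_m _]].
  by apply/(up_mul _ aN le_m).
have [lt_nN|le_Nn] := ltnP n N.
  by left; rewrite mem_filter an eqxx mem_iota.
right; pose m := (N + (n - N) %% k)%N.
have nE : n = (m + k * ((n - N) %/ k))%N.
  by rewrite /m -addnA addnC [(k * _)%N]mulnC [(_ %% _ + _)%N]addnC -divn_eq subnK.
exists (m, k); last by exists ((n - N) %/ k)%N.
apply/map_f; rewrite mem_filter mem_iota leq_addr ltn_add2l ltn_mod k_gt0 !andbT.
by apply/eqP; apply/(up_mul ((n - N) %/ k) aN (leq_addr _ _)); rewrite -/m -nE.
Qed.

(** * Residue fields of prime ideals *)

Section PrimeQuotient.
Local Open Scope quotient_scope.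

Lemma prime_residue_field (A : comNzRingType) (P : A^o -> Prop) :
    submod P -> ~ P 1 -> (forall u v : A, P (u * v) -> P u \/ P v) ->
  exists (L : fieldType) (phi : {rmorphism A -> L}),
    forall a, phi a = 0 <-> P a.
Proof.
move=> sP P1 prP; pose S : pred A := fun x => `[< P x >].
have S_idl : idealr_closed S.
  split=> [||a x y /asboolP Px /asboolP Py]; first by apply/asboolP; case: sP.
    by apply/asboolP.
  by apply/asboolP; apply: sP.2.
have S_pr : prime_idealr_closed S.
  by move=> u v /asboolP/prP[?|?]; apply/orP; [left|right]; apply/asboolP.
pose SZ := GRing.isZmodClosed.Build A S (idealr_closedB S_idl).
pose SP := isProperIdeal.Build A S (idealr_closed_nontrivial S_idl).
pose SPr := isPrimeIdealrClosed.Build A S S_pr.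
pose I : prime_idealr A := HB.pack S SZ SP SPr.
pose Q : comNzRingType := {ideal_quot I}.
(* Inverses in A/P are chosen classically, which makes it an integral domain whose fraction field
   can be formed. *)
pose unitQ : pred Q := fun x => `[< exists y, y * x = 1 >].
have inv_ex (x : Q) : exists y, if unitQ x then y * x = 1 else y = x.
  by rewrite /unitQ; case: asboolP => [[y e]|_]; [exists y | exists x].
have [invQ invQP] := choice inv_ex.
have mulVQ : {in unitQ, left_inverse 1 invQ *%R}.
  by move=> x ux; have := invQP x; rewrite (ux : unitQ x = true).
have unitQP x y : y * x = 1 -> unitQ x by move=> e; apply/asboolP; exists y.
have invQ_out : {in [predC unitQ], invQ =1 id}.
  by move=> x /negPf ux; have := invQP x; rewrite (ux : unitQ x = false).
pose QU := GRing.ComNzRing_hasMulInverse.Build Q mulVQ unitQP invQ_out.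
pose U : comUnitRingType := HB.pack Q QU.
have Q_dom : GRing.integral_domain_axiom U.
  by move=> x y /(@Quotient.rquot_IdomainAxiom _ I x y).
pose UD := GRing.ComUnitRing_isIntegral.Build U Q_dom.
pose D : idomainType := HB.pack U UD.
pose pi : {rmorphism A -> Q} := \pi_Q.
pose phi : {rmorphism A -> {fraction D}} :=
  (@FracField.tofrac D : {rmorphism D -> {fraction D}}) \o (pi : {rmorphism A -> D}).
exists {fraction D}, phi => a.
have -> : phi a = 0 <-> pi a = 0.
  by split=> [/eqP|e]; rewrite /phi /= ?e ?rmorph0 // tofrac_eq0 => /eqP.
split=> [/eqP|Pa]; last apply/eqP.
  by rewrite -[0](rmorph0 pi) -Quotient.idealrBE subr0 => /asboolP.
by rewrite -[0](rmorph0 pi) -Quotient.idealrBE subr0; apply/asboolP.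
Qed.
End PrimeQuotient.

(** * Dévissage of the zero set *)

(** Determinant trick: [B] is the matrix of multiplication by X^k on A[X]/(f'), so X^k - B maps the
    column (1, X, ..., X^d) to a multiple of f'. Applying the adjugate and reading the entry of 1
    gives the characteristic polynomial at X^k. *)
Lemma exists_subseq_monic (A : comNzRingType) (f : {poly A}) (k : nat) :
    f \is monic ->
  exists2 g : {poly A}, g \is monic & exists h, g \Po 'X^k = f * h.
Proof.
(* The extra factor X keeps the rank of A[X]/(f') positive even if f = 1. *)
move=> f_monic; pose f' := f * 'X.
have f'_monic : f' \is monic by rewrite monicMl // monicX.
have [d sf'] : exists d, size f' = d.+2.
  rewrite /f' size_mulX ?monic_neq0 //; exists (size f).-1.
  by rewrite prednK // size_poly_gt0 monic_neq0.
pose B : 'M[A]_d.+1 := \matrix_(i, j) (Pdiv.Ring.rmodp ('X^k * 'X^i) f')`_j.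
exists (char_poly B); first exact: char_poly_monic.
pose M := map_mx (comp_poly 'X^k : {rmorphism {poly A} -> {poly A}}) (char_poly_mx B).
pose x : 'cV[{poly A}]_d.+1 := \col_i 'X^i.
pose y : 'cV[{poly A}]_d.+1 := \col_i Pdiv.Ring.rdivp ('X^k * 'X^i) f'.
have Mx : M *m x = f' *: y.
  apply/colP => i; rewrite !mxE.
  rewrite (eq_bigr (fun j : 'I_d.+1 =>
    (i == j)%:R * ('X^k * 'X^j) - B i j *: 'X^j)); last first.
    move=> j _; rewrite !mxE rmorphB rmorphMn /= comp_polyX comp_polyC mulrBl.
    by rewrite mul_polyC; congr (_ - _); rewrite -mulr_natl mulrA.
  rewrite sumrB (bigD1 i) //= eqxx mul1r big1 ?addr0; last first.
    by move=> j; rewrite eq_sym => /negPf->; rewrite mul0r.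
  apply/eqP; rewrite subr_eq; apply/eqP.
  rewrite [LHS](Pdiv.RingMonic.rdivp_eq f'_monic) mulrC; congr (_ + _).
  have sr : (size (Pdiv.Ring.rmodp ('X^k * 'X^i) f') <= d.+1)%N.
    by rewrite -ltnS -sf' Pdiv.Ring.ltn_rmodpN0 // monic_neq0.
  rewrite -[LHS](coefK) poly_def (big_ord_widen d.+1 (fun j => _`_j *: 'X^j) sr).
  rewrite big_mkcond; apply: eq_bigr => j _; rewrite !mxE.
  by case: ltnP => // le; rewrite nth_default // scale0r.
have : (\adj M *m (M *m x)) 0 0 = char_poly B \Po 'X^k.
  by rewrite mulmxA mul_adj_mx mul_scalar_mx !mxE expr0 mulr1 det_map_mx.
move=> <-; rewrite Mx -scalemxAr mxE /f' -mulrA.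
by exists ('X * (\adj M *m y) 0 0).
Qed.

(** A polynomial q acts on the subsequence as q(X^k) acts on [b], up to a shift by [r], and g(X^k)
    is a multiple of [f]. *)
Lemma kills_subseq (A : comNzRingType) (f : {poly A}) (k : nat) : f \is monic ->
  exists2 g : {poly A}, g \is monic &
    forall (V : lmodType A) (b : nat -> V) r,
      kills f b -> kills g (fun n => b (k * n + r)%N).
Proof.
move=> /(exists_subseq_monic k)[g g_monic [h ghE]]; exists g => // V b r fb n.
have pairingE q : pairing (fun n => b (k * n + r)%N) q = pairing b ('X^r * (q \Po 'X^k)).
  rewrite -[q in RHS]coefK poly_def raddf_sum mulr_sumr linear_sum.
  apply: eq_bigr => i _ /=; rewrite comp_polyZ comp_Xn_poly -exprM -scalerAr.
  by rewrite linearZ /= -exprD pairingXn addnC.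
by rewrite pairingE comp_polyM ghE mulrCA -!mulrA (kills_mul _ fb).
Qed.

Lemma up_field (A : comNzRingType) (L : fieldType) (phi : {rmorphism A -> L})
    (f : {poly A}) (b : nat -> A^o) :
    skolem_images A -> [pchar L] =i pred0 -> f \is monic -> kills f b ->
  ultimately_periodic (fun n => phi (b n) = 0).
Proof.
move=> skA L0 f_monic fb; have [K skK [io ioP]] := skA L phi L0.
have [y yE] := choice ioP.
pose fK := \poly_(i < size f) y f`_i.
have fKE : map_poly io fK = map_poly phi f.
  apply/polyP => i; rewrite !coef_map coef_poly /=.
  case: ltnP => [_|le]; first by rewrite -yE.
  by rewrite nth_default /= ?rmorph0.
have nz_fK : fK != 0.
  by rewrite -(map_poly_eq0 io) fKE monic_neq0 // monic_map.
(* Removing X^s makes the constant term nonzero, at the price of the first [s] terms of the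
   sequence. *)
have [s [F rootF fKF]] := multiplicity_XsubC fK 0.
have F0 : F`_0 != 0 by move: rootF; rewrite nz_fK rootE horner_coef0.
pose b' n : K^o := y (b (n + s)%N).
have Fb' : kills (F ^+ 1) b'.
  move=> n; apply: (fmorph_inj io); rewrite expr1 rmorph0.
  have io_pairing q :
      io (pairing b' q) = pairing (fun m => phi (b m) : L^o) ('X^s * map_poly io q).
    rewrite pairing_shift.
    rewrite [RHS](pairingE _ (size_poly (size q) _ : (size (map_poly io q) <= _)%N)).
    rewrite [LHS]raddf_sum; apply: eq_bigr => i _; rewrite coef_map /= yE.
    exact: rmorphM.
  have XsF : 'X^s * map_poly io F = map_poly phi f.
    by rewrite -fKE fKF subr0 rmorphM rmorphXn /= map_polyX mulrC.
  rewrite io_pairing rmorphM mulrA XsF /= map_polyXn -(map_polyXn phi) -rmorphM.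
  rewrite (pairingE _ (size_poly (size (f * 'X^n)) _ : (size (map_poly phi _) <= _)%N)).
  rewrite -[RHS](rmorph0 phi) -[in RHS](fb n) [RHS]raddf_sum.
  apply: eq_bigr => i _; rewrite coef_map; exact/esym/rmorphM.
have [k k_gt0 skF] := skK F F0.
apply: (@up_shift _ s); apply: (up_classes k_gt0) => r.
have bz n : phi (b (n + s)%N) = 0 <-> b' n = 0.
  rewrite yE -[y _]/(b' n); split=> [/eqP|->]; last exact: rmorph0.
  by rewrite fmorph_eq0 => /eqP.
have [inf_z|] := pselect (forall N, exists2 n, (N <= n)%N & b' (k * n + r)%N = 0).
  by apply: (@up_const _ 0%N) => m n _ _ _; apply/bz; apply: skF inf_z n.
move/existsNP => [N noz]; apply: (@up_const _ N) => m n le_m _ /bz bm.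
by case: noz; exists m.
Qed.

(* Where [b n = y n + alpha n *: u] with [y n] in [N], the coefficients [alpha]
   can be replaced by a recurrence sequence with the same initial values. *)
Lemma up_devissage (A : comNzRingType) (V : lmodType A) (N : V -> Prop) (u : V)
    (f : {poly A}) (b : nat -> V) :
    submod N -> f \is monic -> kills f b ->
    ultimately_periodic (fun n => exists alpha, N (b n - alpha *: u)) ->
    (forall (g : {poly A}) (c : nat -> A^o), g \is monic -> kills g c ->
      ultimately_periodic (fun n => N (c n *: u))) ->
  ultimately_periodic (fun n => N (b n)).
Proof.
move=> sN f_monic fb [N0 [k [k_gt0 perW]]] upc.
apply: (@up_shift _ N0); apply: (up_classes k_gt0) => r.
have [g g_monic gP] := kills_subseq k f_monic.
have {gP} gb := gP V b (r + N0)%N fb.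
pose b' n := b (k * n + (r + N0))%N.
apply: (@up_iff (fun n => N (b' n))) => [|n]; last by rewrite /b' addnA.
pose W n := exists alpha, N (b n - alpha *: u).
have Wr n : W (r + N0)%N <-> W (k * n + (r + N0))%N.
  by rewrite [(k * n + _)%N]addnC; apply: (@up_mul W N0 k n _ perW (leq_addl _ _)).
(* The terms on this class lie in N + A u all together or not at all; in the latter case none lies
   in [N]. *)
have [W0|nW0] := pselect (W (r + N0)%N); last first.
  apply: (@up_const _ 0%N) => m n _ _ Nm; case: nW0; apply/(Wr m).
  by exists 0; rewrite scale0r subr0.
have [alpha alphaP] := choice (fun n => (Wr n).1 W0).
pose y n := b' n - alpha n *: u.
pose c : nat -> A^o := extend (V := A^o) g alpha.
have upC := upc g c g_monic (kills_extend (V := A^o) g_monic alpha).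
apply: (up_iff upC) => n.
have -> : b' n = pairing y (Pdiv.Ring.rmodp 'X^n g) + c n *: u.
  rewrite -[b' n]pairingXn (kills_rmodp g_monic _ gb) /c /extend /pairing scaler_suml.
  rewrite -big_split; apply: eq_bigr => i _ /=.
  by rewrite -[b _]/(b' i) -[in LHS](subrK (alpha i *: u) (b' i)) scalerDr scalerA.
have Ny : N (pairing y (Pdiv.Ring.rmodp 'X^n g)).
  by apply: submod_sum => // i; apply: submodZ => //; apply: alphaP.
split=> [Nc|Nyc]; first exact: submodD.
by rewrite -(addKr (pairing y (Pdiv.Ring.rmodp 'X^n g)) (c n *: u)) addrC; apply: submodB.
Qed.

(** Noetherian induction. For prime [J], pass to the residue field. If [J] contains u v but neither
    factor, dévissage along [u] involves the ideals J + A u and (J : u), which are strictly larger: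
    they contain [u] and [v] respectively. *)
Lemma up_ideal (A : comNzRingType) (J : A^o -> Prop) :
    noetherian A -> skolem_images A -> (forall L : fieldType,
      {rmorphism A -> L} -> [pchar L] =i pred0) -> submod J ->
  forall (f : {poly A}) (b : nat -> A^o), f \is monic -> kills f b ->
    ultimately_periodic (fun n => J (b n)).
Proof.
move=> nA skA A0; move: J.
apply: (noetherian_ind (P := fun J => forall (f : {poly A}) (b : nat -> A^o),
  f \is monic -> kills f b -> ultimately_periodic (fun n => J (b n))) nA).
move=> J sJ IH f b f_monic fb.
have [J1|nJ1] := pselect (J 1).
  apply: (@up_const _ 0%N) => m n _ _ _.
  by rewrite -[b n]mulr1; apply: (submodZ (b n) sJ J1).
have [prJ|] := pselect (forall u v : A, J (u * v) -> J u \/ J v).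
  have [L [phi phiP]] := prime_residue_field sJ nJ1 prJ.
  have upL := up_field phi skA (A0 L phi) f_monic fb.
  apply: (up_iff upL) => n.
  exact: phiP.
move=> /existsNP[u] /existsNP[v] /not_implyP[Juv] /not_orP[nJu nJv].
apply: (up_devissage (u := u : A^o) sJ f_monic fb).
  apply: (IH (fun x => exists alpha : A, J (x - alpha *: (u : A^o)))) f_monic fb.
  - split=> [|a x y [al Jx] [be Jy]].
      by exists 0; rewrite scale0r subr0; case: sJ.
    exists (a * al + be); rewrite scalerDl -scalerA opprD addrACA -scalerBr.
    exact: sJ.2.
  - by move=> x Jx; exists 0; rewrite scale0r subr0.
  - by exists u => //; exists 1; rewrite scale1r subrr; case: sJ.
move=> g c; apply: (IH (fun x : A^o => J (x *: (u : A^o)))).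
- split=> [|a x y Jx Jy]; first by rewrite scale0r; case: sJ.
  by rewrite scalerDl -scalerA; apply: sJ.2.
- move=> x Jx; rewrite -[_ *: _]/(x * u : A) mulrC; exact: (submodZ u sJ Jx).
- by exists v => //; rewrite -[_ *: _]/(v * u : A) mulrC.
Qed.

(** All values lie in the span of the first terms. Generators are discarded one at a time, each [u]
    through the ideal of the x with x u in the remaining span, until the span is zero. *)
Lemma up_zero_module (A : comNzRingType) (V : lmodType A) (f : {poly A})
    (a : nat -> V) :
    noetherian A -> skolem_images A -> (forall L : fieldType,
      {rmorphism A -> L} -> [pchar L] =i pred0) ->
    f \is monic -> kills f a -> ultimately_periodic (fun n => a n = 0).
Proof.
move=> nA skA A0 f_monic fa.
have : ultimately_periodic (fun n => lspan (mkseq a (size f).-1) (a n)).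
  apply: (@up_const _ 0%N) => _ n _ _ _.
  rewrite -[a n]pairingXn (kills_rmodp f_monic _ fa).
  rewrite (pairingE _ (size_rmodp_monic f_monic _)).
  apply: submod_sum => [|i]; first exact: lspan_submod.
  apply: submodZ; first exact: lspan_submod.
  by apply/lspan_mem/map_f; rewrite mem_iota /=.
elim: (mkseq _ _) => [|u s IHs] up_s.
  apply: (up_iff up_s) => n; split=> [[c ->]|->]; first by rewrite big_ord0.
  exact: (lspan_submod _).1.
apply: IHs; apply: (@up_devissage _ _ _ u f) => //.
- exact: lspan_submod.
- by apply: (up_iff up_s) => n; apply: lspan_cons.
move=> g c; apply: (@up_ideal _ (fun x : A^o => lspan s (x *: u))) => //.
split=> [|x y z Jy Jz]; first by rewrite scale0r; apply: (lspan_submod _).1.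
by rewrite scalerDl -scalerA; apply: (lspan_submod _).2.
Qed.

(** * Reduction to a polynomial ring over the rationals *)

(** An alias of [M], on which [A] can act through [psi] beside the action of [R] on [M]. *)
Definition restrict_scalars (A : comNzRingType) (R : comPzRingType)
  (psi : {rmorphism A -> R}) (M : lmodType R) : Type := M.

Section RestrictScalars.
Variables (A : comNzRingType) (R : comPzRingType) (psi : {rmorphism A -> R}).
Variable M : lmodType R.
Local Notation M' := (restrict_scalars psi M).

HB.instance Definition _ := GRing.Zmodule.on M'.

Definition restrict_scale (a : A) (x : M') : M' := psi a *: (x : M).

Lemma restrict_scaleA a b x :
  restrict_scale a (restrict_scale b x) = restrict_scale (a * b) x.
Proof. by rewrite /restrict_scale scalerA rmorphM. Qed.

Lemma restrict_scale1 : left_id 1 restrict_scale.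
Proof. by move=> x; rewrite /restrict_scale rmorph1 scale1r. Qed.

Lemma restrict_scaleDr : right_distributive restrict_scale +%R.
Proof. by move=> a x y; rewrite /restrict_scale scalerDr. Qed.

Lemma restrict_scaleDl x : {morph restrict_scale^~ x : a b / a + b}.
Proof. by move=> a b; rewrite /restrict_scale rmorphD scalerDl. Qed.

HB.instance Definition _ := GRing.Zmodule_isLmodule.Build A M'
  restrict_scaleA restrict_scale1 restrict_scaleDr restrict_scaleDl.

End RestrictScalars.

(** [A] is a polynomial ring over Q with one variable per element of [gs]. The morphism from Q to
    [A] forces characteristic 0 on every field that receives [A]. *)
Lemma polynomial_cover (R : comNzRingType) (qalg : {rmorphism rat -> R}) (gs : seq R) :
  exists2 A : comNzRingType, noetherian A /\ skolem_images A &
  exists (_ : {rmorphism rat -> A}) (psi : {rmorphism A -> R}),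
    forall x, x \in gs -> exists y, psi y = x.
Proof.
elim: gs => [|x gs [A [nA skA] [qA [psi psiP]]]].
  exists (rat : comNzRingType); last by exists idfun, qalg.
  by split; [apply: noetherian_field | apply: skolem_images_rat].
exists ({poly A} : comNzRingType).
  by split; [apply: noetherian_poly | apply: skolem_images_poly].
exists (polyC \o qA).
have cfx : commr_rmorph psi x by move=> y; apply: mulrC.
exists (horner_morph cfx) => y; rewrite inE => /orP[/eqP->|/psiP[z <-]].
  by exists 'X; rewrite /= horner_morphX.
by exists z%:P; rewrite /= horner_morphC.
Qed.

Lemma up_recurrence (R : comPzRingType) (qalg : {rmorphism rat -> R})
    (M : lmodType R) (a : nat -> M) :
  is_recurrence a -> ultimately_periodic (fun n => a n = 0).
Proof.
move=> [d [gamma aE]].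
(* Over the zero ring [M] is zero; otherwise [R] is a nonzero ring, as [polynomial_cover]
   requires. *)
have [R0|nzR] := eqVneq (1 : R) 0.
  by apply: (@up_const _ 0%N) => m n _ _ _; rewrite -[a n]scale1r R0 scale0r.
pose RN := GRing.PzSemiRing_isNonZero.Build R nzR.
pose R' : comNzRingType := HB.pack R RN.
have [A [nA skA] [qA [psi psiP]]] :=
  @polynomial_cover R' qalg [seq gamma i | i <- enum 'I_d].
have gP (i : 'I_d) : exists y, psi y = gamma i.
  by apply: psiP; apply/map_f; rewrite mem_enum.
have [g gE] := choice gP.
pose V : lmodType A := restrict_scalars (psi : {rmorphism A -> R}) M.
pose q := \sum_(i < d) g i *: 'X^i.
(* The characteristic polynomial of the recurrence, lifted to [A] by preimages [g i] of the
   [gamma i]. *)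
pose f : {poly A} := 'X^d - q.
have sq : (size q < d.+1)%N.
  rewrite ltnS (leq_trans (size_sum _ _ _)) //; apply/bigmax_leqP => i _.
  by rewrite (leq_trans (size_scale_leq _ _)) // size_polyXn.
have f_monic : f \is monic.
  by rewrite monicE lead_coefDl ?lead_coefXn // size_polyN size_polyXn.
apply: (@up_zero_module A V f a nA skA _ f_monic) => [L phi n|n].
  have := fmorph_pchar (phi \o qA) n; rewrite pchar_num => /esym; exact.
rewrite /f mulrBl linearB /= -exprD pairingXn addnC aE.
apply/eqP; rewrite subr_eq0 mulr_suml linear_sum; apply/eqP.
apply: eq_bigr => i _; rewrite -scalerAl linearZ /= -exprD pairingXn.
by rewrite -gE addnC.
Qed.

(* R is a commutative Q-algebra: a commutative ring with a (unital) ring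
   morphism from the rationals. *)
Theorem theorem1p2 (R : comPzRingType) (qalg : {rmorphism rat -> R})
    (M : lmodType R) (a : nat -> M) :
  is_recurrence a ->
  exists (F : seq nat) (P : seq (nat * nat)),
    (forall p, p \in P -> (0 < p.2)%N) /\
    (forall n : nat,
       zero_set a n <-> (n \in F \/ exists2 p, p \in P & in_AP p.1 p.2 n)).
Proof. by move=> /(up_recurrence qalg)/up_zero_set. Qed.
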